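(* Let $\alpha\colon A\to A$ and $\beta\colon B\to B$ be endomorphisms of finitely generated abelian groups, and let $M=(A,\alpha)$ and $N=(B,\beta)$ be the associated $\mathbb{Z}[t]$-modules. Then $\alpha$ and $\beta$ are shift equivalent if and only if $M[t^{-1}]\cong N[t^{-1}]$ as $\mathbb{Z}[t,t^{-1}]$-modules.
   Context: For an abelian group $A$ with endomorphism $\alpha$, the $\mathbb{Z}[t]$-module $(A,\alpha)$ is $A$ with $t\cdot x=\alpha(x)$. $M[t^{-1}]$ denotes the localization of the $\mathbb{Z}[t]$-module $M$ at the powers of $t$ (equivalence classes of fractions $x/t^i$, $x\in M$, $i\ge 0$, with $x/t^i\equiv y/t^j$ iff $t^{j+m}x=t^{i+m}y$ for some $m>0$). Endomorphisms $\alpha\colon A\to A$ and $\beta\colon B\to B$ of abelian groups are shift equivalent if there exist group homomorphisms $r\colon A\to B$, $s\colon B\to A$ and a positive integer $m$ such that $r\circ\alpha=\beta\circ r$, $s\circ\beta=\alpha\circ s$, $s\circ r=\alpha^m$ and $r\circ s=\beta^m$. *)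

(* Defs.v *)
From HB Require Import structures.
From mathcomp Require Import all_boot all_algebra.
From mathcomp Require Import boolp.
From mathcomp Require Import zify.

Set Implicit Arguments.
Unset Strict Implicit.
Unset Printing Implicit Defensive.

Import GRing.Theory.
Local Open Scope ring_scope.
Local Open Scope quotient_scope.

Definition finitely_generated (A : zmodType) : Prop :=
  exists (n : nat) (s : n.-tuple A), forall x : A, inIntSpan s x.

Definition shift_equivalent (A B : zmodType)
    (alpha : {additive A -> A}) (beta : {additive B -> B}) : Prop :=
  exists (r : {additive A -> B}) (s : {additive B -> A}) (m : nat),
    [/\ (0 < m)%N,
        r \o alpha =1 beta \o r,
        s \o beta =1 alpha \o s,
        s \o r =1 iter m alpha
      & r \o s =1 iter m beta].

Definition lmod_isomorphic (R : pzRingType) (U V : lmodType R) : Prop :=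
  exists f : {linear U -> V}, bijective f.

(* An alias of A, so that the module structure below can depend on alpha. *)
Definition tmod (A : zmodType) (alpha : {additive A -> A}) : Type := A.

HB.instance Definition _ (A : zmodType) (alpha : {additive A -> A}) :=
  GRing.Zmodule.copy (tmod alpha) A.

Section TMod.
Variables (A : zmodType) (alpha : {additive A -> A}).

Definition tmod_scale (p : {poly int}) (x : tmod alpha) : tmod alpha :=
  \sum_(i < size p) iter i alpha x *~ p`_i.

Lemma tmod_scale_widen n (p : {poly int}) x : (size p <= n)%N ->
  tmod_scale p x = \sum_(i < n) iter i alpha x *~ p`_i.
Proof.
move=> le_pn; rewrite /tmod_scale (big_ord_widen n
  (fun i => iter i alpha x *~ p`_i)) // big_mkcond /=.
by apply: eq_bigr => i _; case: ltnP => // le_pi; rewrite nth_default.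
Qed.

Lemma iter_additiveD n x y :
  iter n alpha (x + y) = iter n alpha x + iter n alpha y.
Proof. by elim: n => //= n ->; rewrite raddfD. Qed.

Fact tmod_scaleDr : right_distributive tmod_scale +%R.
Proof.
move=> p x y; rewrite /tmod_scale -big_split /=.
by apply: eq_bigr => i _; rewrite iter_additiveD mulrzDl.
Qed.

Fact tmod_scaleDl x : {morph tmod_scale^~ x : p q / p + q}.
Proof.
move=> p q; pose n := maxn (size p) (size q).
rewrite !(@tmod_scale_widen n) ?leq_maxl ?leq_maxr ?size_polyD //.
by rewrite -big_split /=; apply: eq_bigr => i _; rewrite coefD mulrzDr.
Qed.

Fact tmod_scale1 : left_id 1 tmod_scale.
Proof. by move=> x; rewrite /tmod_scale size_poly1 big_ord1 coef1. Qed.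

Lemma tmod_scaleC c x : tmod_scale c%:P x = x *~ c.
Proof.
by rewrite (@tmod_scale_widen 1) ?size_polyC ?leq_b1 // big_ord1 coefC.
Qed.

Lemma tmod_scaleMX p x : tmod_scale (p * 'X) x = tmod_scale p (alpha x).
Proof.
rewrite (@tmod_scale_widen (size p).+1); last first.
  by rewrite (leq_trans (size_polyMleq _ _)) // size_polyX addn2.
rewrite big_ord_recl coefMX mulr0z add0r.
by apply: eq_bigr => i _; rewrite coefMX /= -iterSr.
Qed.

Lemma tmod_scale_alpha p x : tmod_scale p (alpha x) = alpha (tmod_scale p x).
Proof.
rewrite /tmod_scale (raddf_sum alpha); apply: eq_bigr => i _.
by rewrite -iterSr /= raddfMz.
Qed.

Fact tmod_scaleA p q x :
  tmod_scale p (tmod_scale q x) = tmod_scale (p * q) x.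
Proof.
elim/poly_ind: p x => [|p c IHp] x.
  by rewrite mul0r /tmod_scale size_poly0 !big_ord0.
rewrite tmod_scaleDl tmod_scaleMX -tmod_scale_alpha IHp mulrDl tmod_scaleDl.
congr (_ + _); first by rewrite -tmod_scaleMX -!mulrA (mulrC q).
rewrite tmod_scaleC mul_polyC (@tmod_scale_widen (size q) (c *: q)) ?size_scale_leq //.
rewrite /tmod_scale mulrz_suml; apply: eq_bigr => i _.
by rewrite coefZ mulrC mulrzA.
Qed.

HB.instance Definition _ := GRing.Zmodule_isLmodule.Build {poly int} (tmod alpha)
  tmod_scaleA tmod_scale1 tmod_scaleDr tmod_scaleDl.

Lemma tmod_scaleX (x : tmod alpha) : 'X *: x = alpha x :> A.
Proof.
have -> : 'X *: x = tmod_scale 'X x by [].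
by rewrite -['X]mul1r tmod_scaleMX tmod_scale1.
Qed.

End TMod.

Section Localization.
Variables (R : comPzRingType) (t : R).

Section Quotient.
Variable M : lmodType R.

(* (x, i) stands for the fraction x / t ^+ i. *)
Definition frac_eq (u v : M * nat) : Prop :=
  exists m, (0 < m)%N /\ t ^+ (v.2 + m) *: u.1 = t ^+ (u.2 + m) *: v.1.

Fact frac_eq_refl : reflexive (fun u v => `[< frac_eq u v >]).
Proof. by move=> u; apply/asboolP; exists 1%N. Qed.

Fact frac_eq_sym : symmetric (fun u v => `[< frac_eq u v >]).
Proof. by move=> u v; apply/asboolP/asboolP => -[m [m_gt0 e]]; exists m. Qed.

Fact frac_eq_trans : transitive (fun u v => `[< frac_eq u v >]).
Proof.
move=> [y j] [x i] [z k] /asboolP[/= m [m0 e1]] /asboolP[/= n [n0 e2]].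
apply/asboolP; exists (j + m + n)%N; split=> /=; first by lia.
have -> : (k + (j + m + n) = (k + n) + (j + m))%N by lia.
have -> : (i + (j + m + n) = (i + m) + (j + n))%N by lia.
rewrite exprD -scalerA e1 scalerA mulrC -scalerA e2.
by rewrite scalerA -exprD.
Qed.

Definition frac_equiv : equiv_rel (M * nat)%type :=
  EquivRel _ frac_eq_refl frac_eq_sym frac_eq_trans.

Definition loc : Type := {eq_quot frac_equiv}.

HB.instance Definition _ := Choice.copy loc {eq_quot frac_equiv}.

Definition locfrac (x : M) (i : nat) : loc := \pi_({eq_quot frac_equiv}) (x, i).

Definition loc_repr (u : loc) : M * nat := repr (u : {eq_quot frac_equiv}).

Lemma locfracP x i y j :
  locfrac x i = locfrac y j <->
  exists m, (0 < m)%N /\ t ^+ (j + m) *: x = t ^+ (i + m) *: y.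
Proof.
split=> [/eqmodP/= |] h; first by move: h; rewrite /frac_equiv /= => /asboolP.
by apply/eqmodP => /=; apply/asboolP.
Qed.

Lemma locfrac_eqI x i y j : t ^+ j *: x = t ^+ i *: y -> locfrac x i = locfrac y j.
Proof.
move=> e; apply/locfracP; exists 1%N; split=> //.
by rewrite ![(_ + 1)%N]addnC !exprD -!scalerA e.
Qed.

Lemma loc_reprK u : locfrac (loc_repr u).1 (loc_repr u).2 = u.
Proof. by rewrite /locfrac -surjective_pairing; apply: reprK. Qed.

Lemma locW (P : loc -> Prop) : (forall x i, P (locfrac x i)) -> forall u, P u.
Proof. by move=> Pf u; rewrite -[u]loc_reprK. Qed.

Definition loc_zero : loc := locfrac 0 0.

Definition loc_opp (u : loc) : loc := locfrac (- (loc_repr u).1) (loc_repr u).2.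

Definition loc_add (u v : loc) : loc :=
  let: (x, i) := loc_repr u in let: (y, j) := loc_repr v in
  locfrac (t ^+ j *: x + t ^+ i *: y) (i + j).

Lemma loc_oppE x i : loc_opp (locfrac x i) = locfrac (- x) i.
Proof.
rewrite /loc_opp; have := loc_reprK (locfrac x i).
move: (loc_repr _) => [y j] /= /locfracP[m [m0 e]].
by apply/locfracP; exists m; rewrite !scalerN e.
Qed.

Lemma loc_addE x i y j :
  loc_add (locfrac x i) (locfrac y j) = locfrac (t ^+ j *: x + t ^+ i *: y) (i + j).
Proof.
rewrite /loc_add; have := loc_reprK (locfrac x i); have := loc_reprK (locfrac y j).
move: (loc_repr (locfrac x i)) (loc_repr (locfrac y j)) => [x' i'] [y' j'] /=.
move=> /locfracP[n [n0 ey]] /locfracP[m [m0 ex]].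
apply/locfracP; exists (m + n)%N; split; first by lia.
rewrite !scalerDr !scalerA -!exprD; congr (_ + _).
  have -> : (i + j + (m + n) + j' = (j + n + j') + (i + m))%N by lia.
  have -> : (i' + j' + (m + n) + j = (j + n + j') + (i' + m))%N by lia.
  by rewrite !(exprD _ (j + n + j')) -!scalerA ex.
have -> : (i + j + (m + n) + i' = (i + m + i') + (j + n))%N by lia.
have -> : (i' + j' + (m + n) + i = (i + m + i') + (j' + n))%N by lia.
by rewrite !(exprD _ (i + m + i')) -!scalerA ey.
Qed.

Fact loc_addA : associative loc_add.
Proof.
elim/locW=> x i; elim/locW=> y j; elim/locW=> z k; rewrite !loc_addE addnA.
congr (locfrac _ _); rewrite !scalerDr !scalerA -!exprD addrA.
by congr (_ *: _ + _ *: _ + _); congr (_ ^+ _); lia.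
Qed.

Fact loc_addC : commutative loc_add.
Proof.
by elim/locW=> x i; elim/locW=> y j; rewrite !loc_addE addnC addrC.
Qed.

Fact loc_add0 : left_id loc_zero loc_add.
Proof.
by elim/locW=> x i; rewrite loc_addE scaler0 add0r expr0 scale1r add0n.
Qed.

Fact loc_addN : left_inverse loc_zero loc_opp loc_add.
Proof.
elim/locW=> x i; rewrite loc_oppE loc_addE scalerN addNr.
by apply: locfrac_eqI; rewrite !scaler0.
Qed.

HB.instance Definition _ :=
  GRing.isZmodule.Build loc loc_addA loc_addC loc_add0 loc_addN.

Lemma locfracD x i y j :
  locfrac x i + locfrac y j = locfrac (t ^+ j *: x + t ^+ i *: y) (i + j).
Proof. exact: loc_addE. Qed.

Lemma locfracDn x y i : locfrac x i + locfrac y i = locfrac (x + y) i.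
Proof.
by rewrite locfracD -scalerDr; apply: locfrac_eqI; rewrite scalerA -exprD.
Qed.

End Quotient.

(* R[t^-1], obtained by localizing R as a module over itself; the ring
   structure comes from its action on localized modules. *)
Definition locring : Type := loc R^o.

HB.instance Definition _ := GRing.Zmodule.copy locring (loc R^o).

Definition loc_scale (M : lmodType R) (a : locring) (u : loc M) : loc M :=
  let: (p, i) := loc_repr a in let: (x, j) := loc_repr u in
  locfrac ((p : R) *: x) (i + j).

Lemma loc_scaleE (M : lmodType R) (p : R) i (x : M) j :
  loc_scale (locfrac (p : R^o) i : locring) (locfrac x j) = locfrac (p *: x) (i + j).
Proof.
rewrite /loc_scale; have := loc_reprK (locfrac x j).
have := loc_reprK (locfrac (p : R^o) i).
move: (loc_repr (locfrac x j)) (loc_repr (locfrac _ i)) => [x' j'] [p' i'] /=.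
move=> /locfracP[n [n0 ep]] /locfracP[m [m0 ex]].
have {}ep : t ^+ (i + n) * p' = t ^+ (i' + n) * p by [].
apply/locfracP; exists (m + n)%N; split; first by lia.
have -> : (i + j + (m + n) = (i + n) + (j + m))%N by lia.
have -> : (i' + j' + (m + n) = (i' + n) + (j' + m))%N by lia.
rewrite !(exprD _ (_ + n)) !scalerA mulrAC ep [in RHS]mulrAC.
by rewrite -!(scalerA (_ * p)) ex.
Qed.

Definition locring_one : locring := locfrac (1 : R^o) 0.

Definition locring_mul (a b : locring) : locring := loc_scale a b.

Fact loc_scaleA (M : lmodType R) (a b : locring) (u : loc M) :
  loc_scale a (loc_scale b u) = loc_scale (locring_mul a b) u.
Proof.
elim/locW: a => p i; elim/locW: b => q j; elim/locW: u => x k.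
by rewrite /locring_mul !loc_scaleE addnA scalerA.
Qed.

Fact loc_scale1 (M : lmodType R) : left_id locring_one (@loc_scale M).
Proof. by elim/locW=> x i; rewrite loc_scaleE scale1r add0n. Qed.

Fact loc_scaleDr (M : lmodType R) : right_distributive (@loc_scale M) +%R.
Proof.
elim/locW=> p i; elim/locW=> x j; elim/locW=> y k.
rewrite locfracD !loc_scaleE locfracD; apply: locfrac_eqI.
rewrite !scalerDr !scalerA -![_ * p * _]mulrAC -!exprD.
by congr (_ ^+ _ * _ *: _ + _ ^+ _ * _ *: _); lia.
Qed.

Fact loc_scaleDl (M : lmodType R) (u : loc M) :
  {morph (@loc_scale M)^~ u : a b / a + b}.
Proof.
elim/locW: u => x k; elim/locW=> p i; elim/locW=> q j.
have -> : (locfrac p i : locring) + locfrac q j =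
    locfrac (t ^+ j * p + t ^+ i * q : R^o) (i + j) by exact: locfracD.
rewrite !loc_scaleE locfracD; apply: locfrac_eqI.
rewrite scalerDl !scalerDr !scalerA !mulrA -!exprD.
by congr (_ *: _ + _ *: _); congr (_ ^+ _ * _); lia.
Qed.

Fact locring_mulC : commutative locring_mul.
Proof.
elim/locW=> p i; elim/locW=> q j; rewrite /locring_mul !loc_scaleE addnC.
by congr (locfrac _ _); apply: mulrC.
Qed.

Fact locring_mulA : associative locring_mul.
Proof. by move=> a b c; apply: loc_scaleA. Qed.

Fact locring_mul1 : left_id locring_one locring_mul.
Proof. exact: loc_scale1. Qed.

Fact locring_mulDl : left_distributive locring_mul +%R.
Proof. by move=> a b c; apply: loc_scaleDl. Qed.

HB.instance Definition _ := GRing.Zmodule_isComPzRing.Build locring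
  locring_mulA locring_mulC locring_mul1 locring_mulDl.

HB.instance Definition _ (M : lmodType R) :=
  GRing.Zmodule_isLmodule.Build locring (loc M)
    (@loc_scaleA M) (@loc_scale1 M) (@loc_scaleDr M) (@loc_scaleDl M).

Lemma locfracZ (M : lmodType R) (p : R) i (x : M) j :
  (locfrac (p : R^o) i : locring) *: locfrac x j = locfrac (p *: x) (i + j).
Proof. exact: loc_scaleE. Qed.

Lemma locfracM (p q : R) i j :
  (locfrac (p : R^o) i : locring) * (locfrac (q : R^o) j : locring) =
  locfrac (p * q : R^o) (i + j).
Proof. exact: loc_scaleE. Qed.

Lemma locfrac_tV :
  (locfrac (t : R^o) 0 : locring) * (locfrac (1 : R^o) 1 : locring) = 1.
Proof. by rewrite locfracM; apply: locfrac_eqI; rewrite scale1r. Qed.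

End Localization.

(* Z[t, t^-1], as the localization of Z[t] at the powers of t. *)
Definition laurent : comPzRingType := locring ('X : {poly int}).

Definition localize (M : lmodType {poly int}) : lmodType laurent :=
  loc ('X : {poly int}) M.

(* Main.v *)
(* A fraction x/t^i vanishes exactly when some power of alpha kills x.  Since
   f.g. abelian groups are Noetherian, one power works for all x, and a linear map
   M[t^-1] -> N[t^-1] sends the image of A into fractions with one common
   denominator.  Hence such a map has the form x/t^i |-> r(x)/t^(i+n) for an
   additive r : A -> B commuting with t.  For mutually inverse maps, with lifts r
   and s, the composites s r and r s agree with powers of alpha and beta up to
   t-torsion; replacing s by alpha^K s with K large removes the torsion. *)

Require Import Defs.
From HB Require Import structures.
From mathcomp Require Import all_boot all_order all_algebra.
From mathcomp Require Import boolp zify.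

Set Implicit Arguments.
Unset Strict Implicit.
Unset Printing Implicit Defensive.

Import Order.TTheory GRing.Theory Num.Theory.
Local Open Scope ring_scope.

(** * Subgroups and stationary chains in finitely generated abelian groups *)

Lemma subrACA (A : zmodType) (x y z w : A) :
  x - y - (z - w) = x - z - (y - w).
Proof. by rewrite !opprD addrACA. Qed.

Definition subgroup (A : zmodType) (P : A -> Prop) : Prop :=
  P 0 /\ forall x y, P x -> P y -> P (x - y).

Section Subgroup.
Variables (A : zmodType) (P : A -> Prop).
Hypothesis sgP : subgroup P.

Lemma subgroupN x : P x -> P (- x).
Proof. by case: sgP => P0 PB Px; rewrite -sub0r; apply: PB. Qed.

Lemma subgroupD x y : P x -> P y -> P (x + y).
Proof.
by move=> Px /subgroupN Py; rewrite -[y]opprK; case: sgP => _; apply.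
Qed.

Lemma subgroupMz x c : P x -> P (x *~ c).
Proof.
move=> Px; have PM n : P (x *+ n).
  by elim: n => [|n IHn]; [case: sgP | rewrite mulrS; apply: subgroupD].
by case: c => n; [apply: PM | apply/subgroupN/PM].
Qed.

End Subgroup.

(** Euclidean division: [d] is the least positive element, or 0 if there is none, and the remainder
    of [c] modulo [d] stays in [P]. *)
Lemma int_subgroup_principal (P : int -> Prop) :
  subgroup P -> exists2 d, P d & forall c, P c -> (d %| c)%Z.
Proof.
move=> sgP; have [P0 PB] := sgP.
have [exP|nexP] := pselect (exists n, (0 < n)%N && `[< P n%:Z >]); last first.
  exists 0 => // c Pc; rewrite dvd0z; apply/eqP; case: c Pc => [[|n] Pc //|n Pc].
    by case: nexP; exists n.+1; apply/asboolP.
  by case: nexP; exists n.+1; apply/asboolP; rewrite -[n.+1%:Z]opprK; apply: subgroupN.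
case: (ex_minnP exP) => d /andP[d_gt0 /asboolP Pd] d_min; exists d%:Z => // c Pc.
have Pm : P (c %% d)%Z.
  have -> : (c %% d)%Z = c - d%:Z *~ (c %/ d)%Z.
    by rewrite {2}(divz_eq c d) -mulrzr mulrC intz addrAC subrr add0r.
  by apply: PB => //; apply: subgroupMz.
apply/dvdz_mod0P; have d0 : d%:Z != 0 by lia.
have lt_md := ltz_mod c d0; have := modz_ge0 c d0.
case: (c %% d)%Z Pm lt_md => // m Pm lt_md _.
case: (posnP m) => [-> //|m_gt0].
have := d_min m; rewrite m_gt0 => /(_ (introT (asboolP _) Pm)); lia.
Qed.

(** Recursive form of the integer span, suited to induction on the list of generators. *)
Fixpoint zspan (A : zmodType) (s : seq A) (x : A) : Prop :=
  if s is a :: s' then exists c : int, zspan s' (x - a *~ c) else x = 0.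

Lemma zspan_subgroup (A : zmodType) (s : seq A) : subgroup (zspan s).
Proof.
elim: s => [|a s [IH0 IHB]]; first by split=> // x y /= -> ->; rewrite subr0.
split=> [|x y [c xc] [d yd]]; first by exists 0; rewrite mulr0z subr0.
by exists (c - d); rewrite mulrzBr subrACA; apply: IHB.
Qed.

Lemma zspan_sum (A : zmodType) (s : seq A) (c : nat -> int) :
  zspan s (\sum_(i < size s) s`_i *~ c i).
Proof.
elim: s c => [|a s IHs] c /=; first by rewrite big_ord0.
exists (c 0%N); rewrite big_ord_recl /= addrC addKr.
exact: IHs (fun i => c i.+1).
Qed.

(* Induction on the number of generators, splitting off the principal
   ideal of the coefficients on the first generator. *)
Lemma zspan_chain (A : zmodType) (s : seq A) (Q : nat -> A -> Prop) :
    (forall k, subgroup (Q k)) ->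
    (forall k l x, (k <= l)%N -> Q k x -> Q l x) ->
  exists k, forall l x, zspan s x -> Q l x -> Q k x.
Proof.
move=> sgQ homoQ; elim: s => [|a s [k1 IH]].
  by exists 0%N => l x /= -> _; case: (sgQ 0%N).
have [sg0 sgB] := zspan_subgroup s.
pose J (c : int) := exists l x, Q l x /\ zspan s (x - a *~ c).
have sgJ : subgroup J.
  split; first by exists 0%N, 0; rewrite mulr0z subr0; case: (sgQ 0%N).
  move=> c d [l [x [Qx xc]]] [k [y [Qy yd]]]; exists (maxn l k), (x - y); split.
    by case: (sgQ (maxn l k)) => _; apply;
      [apply: homoQ Qx; apply: leq_maxl | apply: homoQ Qy; apply: leq_maxr].
  have -> : x - y - a *~ (c - d) = x - a *~ c - (y - a *~ d).
    by rewrite mulrzBr subrACA.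
  exact: sgB.
have [d [k0 [x0 [Qx0 x0d]]] J_dvd] := int_subgroup_principal sgJ.
exists (maxn k0 k1) => l x [c xc] Qx.
have /dvdzP[q] : (d %| c)%Z by apply: J_dvd; exists l, x.
rewrite mulrC => cE.
have Qx0q m : (k0 <= m)%N -> Q m (x0 *~ q).
  by move=> le_m; apply: subgroupMz => //; apply: homoQ Qx0.
rewrite -[x](subrK (x0 *~ q)); apply: subgroupD => //; last exact/Qx0q/leq_maxl.
apply: (homoQ k1); first exact: leq_maxr.
(* As [c = d * q], subtracting [x0 *~ q] cancels the coefficient of [a] and leaves an element of the
   span of [s]. *)
apply: (IH (maxn l k0)).
  have -> : x - x0 *~ q = x - a *~ c - (x0 - a *~ d) *~ q.
    by rewrite mulrzBl -mulrzA -cE subrACA subrr subr0.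
  by apply: sgB => //; apply: subgroupMz => //; apply: zspan_subgroup.
case: (sgQ (maxn l k0)) => _; apply; first by apply: homoQ Qx; apply: leq_maxl.
exact/Qx0q/leq_maxr.
Qed.

Lemma finitely_generated_chain (A : zmodType) (Q : nat -> A -> Prop) :
    finitely_generated A -> (forall k, subgroup (Q k)) ->
    (forall k l x, (k <= l)%N -> Q k x -> Q l x) ->
  exists k, forall l x, Q l x -> Q k x.
Proof.
move=> [n [s span_s]] sgQ homoQ.
have [k Qk] := zspan_chain (tval s) sgQ homoQ.
exists k => l x; apply: Qk; have [c ->] := span_s x.
(* The coefficients, indexed by ordinals, are extended by 0 to all of [nat]. *)
have := zspan_sum s (fun i => oapp c 0 (insub i)); rewrite size_tuple.
by congr zspan; apply: eq_bigr => i _; rewrite valK.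
Qed.

(** * Iterates and equality of fractions *)

Lemma iter_additiveB (A : zmodType) (alpha : {additive A -> A}) n x y :
  iter n alpha (x - y) = iter n alpha x - iter n alpha y.
Proof. by elim: n => //= n ->; rewrite raddfB. Qed.

Lemma iter_comm (A B : Type) (alpha : A -> A) (beta : B -> B) (r : A -> B) n :
  r \o alpha =1 beta \o r ->
  forall x, r (iter n alpha x) = iter n beta (r x).
Proof. by move=> rC x; elim: n => //= n <-; apply: rC. Qed.

Lemma locfracBn (R : comPzRingType) (t : R) (M : lmodType R) (x y : M) i :
  locfrac t x i - locfrac t y i = locfrac t (x - y) i.
Proof. by rewrite [- _]loc_oppE locfracDn. Qed.

Section Localize.
Variables (M : lmodType {poly int}).

Lemma localizeZ (p : {poly int}) i (x : M) j :
  (locfrac 'X (p : {poly int}^o) i : laurent) *: (locfrac 'X x j : localize M) =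
  locfrac 'X (p *: x) (i + j).
Proof. exact: locfracZ. Qed.

Lemma localizeD (x y : M) i j :
  (locfrac 'X x i : localize M) + (locfrac 'X y j : localize M) =
  locfrac 'X ('X^j *: x + 'X^i *: y) (i + j).
Proof. exact: locfracD. Qed.

End Localize.

Section TModLocalization.
Variables (A : zmodType) (alpha : {additive A -> A}).

Local Notation frac x i := (locfrac 'X (x : tmod alpha) i).

Lemma tmod_scaleXn n (x : tmod alpha) : 'X^n *: x = iter n alpha x :> A.
Proof.
by elim: n => [|n IHn]; rewrite ?scale1r // exprS -scalerA tmod_scaleX IHn.
Qed.

Lemma tmod_fracP x i y j :
  frac x i = frac y j <->
  exists m, (0 < m)%N /\ iter (j + m) alpha x = iter (i + m) alpha y.
Proof.
rewrite locfracP; split=> -[m [m0 e]]; exists m; split=> //.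
  by rewrite -!tmod_scaleXn.
by rewrite !tmod_scaleXn.
Qed.

Lemma tmod_frac_eqI x i y j :
  iter j alpha x = iter i alpha y -> frac x i = frac y j.
Proof. by move=> e; apply: locfrac_eqI; rewrite !tmod_scaleXn. Qed.

(* Finite generation makes the auxiliary exponent in the equality of fractions
   uniform, because the increasing chain of kernels of the iterates is stationary. *)
Lemma tmod_frac_bound (fgA : finitely_generated A) :
  exists k, forall x i y j, frac x i = frac y j ->
    iter (j + k) alpha x = iter (i + k) alpha y.
Proof.
have [||k kerP] := @finitely_generated_chain A (fun m x => iter m alpha x = 0) fgA.
- move=> m; split; first by have := iter_additiveB alpha m 0 0; rewrite !subrr.
  by move=> x y ex ey; rewrite iter_additiveB ex ey subrr.
- move=> m l x le_ml ex; rewrite -(subnK le_ml) iterD ex.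
  by have := iter_additiveB alpha (l - m) 0 0; rewrite !subrr.
exists k => x i y j /tmod_fracP[m [_ e]].
rewrite ![(_ + k)%N]addnC !iterD; apply/eqP; rewrite -subr_eq0 -iter_additiveB.
by apply/eqP/(kerP m); rewrite iter_additiveB -!iterD ![(m + _)%N]addnC e subrr.
Qed.

End TModLocalization.

(** * From shift equivalences to isomorphisms of localizations *)

Section InducedMap.
Variables (A B : zmodType) (alpha : {additive A -> A}) (beta : {additive B -> B}).
Variables (r : {additive A -> B}) (rC : r \o alpha =1 beta \o r).

Local Notation fracA x i := (locfrac 'X (x : tmod alpha) i).
Local Notation fracB x i := (locfrac 'X (x : tmod beta) i).

Definition loc_map (u : localize (tmod alpha)) : localize (tmod beta) :=
  fracB (r (loc_repr u).1) (loc_repr u).2.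

Lemma loc_mapE x i : loc_map (fracA x i) = fracB (r x) i.
Proof.
rewrite /loc_map; have := loc_reprK (fracA x i).
move: (loc_repr _) => [y j] /= /tmod_fracP[m [m0 e]].
apply/tmod_fracP; exists m; split=> //.
by have := congr1 r e; rewrite !(iter_comm _ rC).
Qed.

Lemma tmod_scale_comm (p : {poly int}) (x : A) :
  r (p *: (x : tmod alpha)) = p *: (r x : tmod beta) :> B.
Proof.
rewrite [LHS](raddf_sum r); apply: eq_bigr => i _.
by rewrite raddfMz (iter_comm _ rC).
Qed.

Lemma loc_map_linear : linear loc_map.
Proof.
move=> a u v; elim/locW: u => x i; elim/locW: v => y j; elim/locW: a => p k.
rewrite localizeZ localizeD !loc_mapE localizeZ localizeD raddfD.
by congr (locfrac _ (_ + _) _); rewrite !tmod_scale_comm.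
Qed.

End InducedMap.

Lemma shift_equivalent_loc_isomorphic (A B : zmodType)
    (alpha : {additive A -> A}) (beta : {additive B -> B}) :
  shift_equivalent alpha beta ->
  lmod_isomorphic (localize (tmod alpha)) (localize (tmod beta)).
Proof.
move=> [r [s [m [_ rC sC srE rsE]]]].
pose f : {linear _ -> _} := HB.pack (@loc_map _ _ alpha beta r)
  (GRing.isLinear.Build _ _ _ _ _ (loc_map_linear rC)).
(* Since [s \o r] acts as t^m, the inverse of [f] is the map induced by [s] divided by t^m. *)
pose tVm : laurent := locfrac 'X (1 : {poly int}^o) m.
exists f, (fun v => tVm *: @loc_map _ _ beta alpha s v).
  elim/locW=> x i; rewrite [f _]loc_mapE // loc_mapE // localizeZ scale1r.
  by apply: tmod_frac_eqI; rewrite [s _](srE x) -iterD addnC.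
elim/locW=> y j; rewrite loc_mapE // localizeZ scale1r [LHS]loc_mapE //.
by apply: tmod_frac_eqI; rewrite [r _](rsE y) -iterD addnC.
Qed.

(** * From isomorphisms of localizations to shift equivalences *)

(* The numerator of f (x / 1) over a common denominator is only determined up to
   t-torsion; multiplying it by a power of t that kills the torsion makes the
   choice canonical, hence additive and compatible with t. *)
Lemma localize_linear_lift (A B : zmodType)
    (alpha : {additive A -> A}) (beta : {additive B -> B})
    (fgA : finitely_generated A) (fgB : finitely_generated B)
    (f : {linear localize (tmod alpha) -> localize (tmod beta)}) :
  exists (r : {additive A -> B}) (n : nat), r \o alpha =1 beta \o r /\
    forall x i, f (locfrac 'X (x : tmod alpha) i) =
                locfrac 'X (r x : tmod beta) (i + n).
Proof.
pose fracA (x : A) i : localize (tmod alpha) := locfrac 'X (x : tmod alpha) i.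
pose fracB (y : B) i : localize (tmod beta) := locfrac 'X (y : tmod beta) i.
have fracB_lift n y i : fracB y i = fracB (iter n beta y) (i + n)%N.
  by apply: tmod_frac_eqI; rewrite -iterD.
have fB x x' : f (fracA (x - x') 0) = f (fracA x 0) - f (fracA x' 0).
  by rewrite -raddfB; congr (f _); symmetry; apply: locfracBn.
(* The elements whose image admits the denominator t^n form an increasing chain of subgroups; its
   stationary stage is the common denominator. *)
have [||n denomP] := @finitely_generated_chain A
    (fun n x => exists y, f (fracA x 0) = fracB y n) fgA.
- move=> n; split; last first.
    move=> x x' [y fx] [y' fx']; exists (y - y').
    by rewrite fB fx fx'; apply: locfracBn.
  exists 0; rewrite [LHS](raddf0 f).
  by apply: locfrac_eqI; rewrite !scaler0.
- move=> m l x le_ml [y fx]; exists (iter (l - m) beta y).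
  by rewrite fx (fracB_lift (l - m)%N y m) subnKC.
have [g fE] : {g : A -> B & forall x, f (fracA x 0) = fracB (g x) n}.
  apply: (@choice _ _ (fun x y => f (fracA x 0) = fracB y n)) => x.
  apply: (denomP (loc_repr (f (fracA x 0))).2).
  by exists (loc_repr (f (fracA x 0))).1; rewrite /fracB loc_reprK.
have [k kP] := tmod_frac_bound beta fgB.
(* Two numerators over t^n agree after [n + k] applications of [beta]: [n] from
   cross-multiplication, [k] from the torsion bound. *)
pose h x := iter (n + k) beta (g x).
have hE x y : f (fracA x 0) = fracB y n -> h x = iter (n + k) beta y.
  by rewrite fE => /kP.
have hB : zmod_morphism h.
  move=> x x'; rewrite (@hE _ (g x - g x')) ?iter_additiveB //.
  by rewrite fB !fE; apply: locfracBn.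
have hC : h \o alpha =1 beta \o h.
  (* By linearity over t, [beta (g x)] is also a numerator of the image of [alpha x]. *)
  move=> x /=; rewrite (@hE _ (beta (g x))) -?iterS ?iterSr //.
  pose T : laurent := locfrac 'X ('X : {poly int}^o) 0.
  have TA : fracA (alpha x) 0 = T *: fracA x 0.
    by rewrite localizeZ tmod_scaleX.
  by rewrite TA linearZ /= fE localizeZ tmod_scaleX.
pose r : {additive A -> B} := HB.pack h (GRing.isZmodMorphism.Build _ _ _ hB).
(* The extra [n + k] in the denominator compensates for the iterate of [beta] in [h]. *)
exists r, (n + (n + k))%N.
split=> // x i.
pose tVi : laurent := locfrac 'X (1 : {poly int}^o) i.
have xiE : fracA x i = tVi *: fracA x 0.
  by rewrite localizeZ scale1r addn0.
rewrite [LHS](congr1 f xiE) linearZ /= fE (fracB_lift (n + k)%N (g x) n).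
by rewrite localizeZ scale1r.
Qed.

Theorem proposition1p1 (A B : zmodType)
    (alpha : {additive A -> A}) (beta : {additive B -> B})
    (fgA : finitely_generated A) (fgB : finitely_generated B) :
  shift_equivalent alpha beta <->
  lmod_isomorphic (localize (tmod alpha)) (localize (tmod beta)).
Proof.
split; first exact: shift_equivalent_loc_isomorphic.
move=> [f [f' fK f'K]].
pose g : {linear _ -> _} := HB.pack f'
  (GRing.isLinear.Build _ _ _ _ _ (can2_linear fK f'K)).
have [r [n [rC fE]]] := localize_linear_lift fgA fgB f.
have [s [p [sC gE]]] := localize_linear_lift fgB fgA g.
have [k kP] := tmod_frac_bound alpha fgA.
have [l lP] := tmod_frac_bound beta fgB.
(* Applying [g] after [f] turns x/1 into s(r(x))/t^(n+p), which must equal x/1. *)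
have srE x : iter k alpha (s (r x)) = iter (n + p + k) alpha x.
  by apply: (kP _ (n + p)%N _ 0%N); rewrite -gE -[n]add0n -fE; apply: fK.
have rsE y : iter l beta (r (s y)) = iter (p + n + l) beta y.
  by apply: (lP _ (p + n)%N _ 0%N); rewrite -fE -[p]add0n -gE; apply: f'K.
(* Here [k] absorbs the torsion in [A] and [l] that in [B], while the 1 makes the final exponent
   positive. *)
have s'B : zmod_morphism (iter (k + l + 1) alpha \o s).
  by move=> x y; rewrite /= raddfB iter_additiveB.
pose s' : {additive B -> A} := HB.pack (iter (k + l + 1) alpha \o s)
  (GRing.isZmodMorphism.Build _ _ _ s'B).
exists r, s', (n + p + k + l + 1)%N.
split=> // [|y|x|y] /=; first by rewrite addn1.
- by rewrite [s _](sC y) -iterSr.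
- have -> : (k + l + 1 = l + 1 + k)%N by lia.
  by rewrite iterD srE -iterD; congr iter; lia.
have -> : (k + l + 1 = k + 1 + l)%N by lia.
rewrite (iter_comm _ rC) iterD rsE -iterD; congr iter; lia.
Qed.
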